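(* Let $C_a>0$, $\delta_a\ge 0$, $a\in\mathcal{K}_{C_a,\delta_a}$, $C>C_a$ and $\delta\ge\delta_a$. Consider the operator $A:\mathcal{K}_{C-C_a,\delta}\to\mathcal{K}_{C,\delta}$ given by $(Ak)(\eta)=(a\ast k)(\eta)$, $\eta\in\Gamma_0$. Then the operator $A$ with domain $\mathcal{K}_{C-C_a,\delta}\subset\mathcal{K}_{C,\delta}$ is closable in the Banach space $\mathcal{K}_{C,\delta}$.
   Context: Let $X$ be a connected oriented non-compact Riemannian $C^\infty$-manifold with Borel $\sigma$-algebra $\mathcal{B}(X)$, and let $\mathcal{B}_{\mathrm c}(X)$ be the class of Borel sets with compact closure. Let $m$ be a non-atomic Radon measure on $X$: $m(\Lambda)<\infty$ for $\Lambda\in\mathcal{B}_{\mathrm c}(X)$ and $m(\{x\})=0$ for $x\in X$. Assume there is an increasing sequence $\Lambda_n\in\mathcal{B}_{\mathrm c}(X)$ with $\bigcup_n\Lambda_n=X$. For $n\in\mathbb{N}$ let $\Gamma^{(n)}=\{\eta\subset X: |\eta|=n\}$, where $|\eta|$ is the number of points of $\eta$; $\Gamma^{(0)}=\{\emptyset\}$. $\Gamma^{(n)}$ is identified with the quotient of $\widetilde{X^n}=\{(x_1,\dots,x_n)\in X^n: x_k\neq x_l \text{ if } k\ne l\}$ by the permutation group $S_n$ and carries the quotient topology. The space of finite configurations is the disjoint union $\Gamma_0=\bigsqcup_{n\ge 0}\Gamma^{(n)}$ with the disjoint-union topology and its Borel $\sigma$-algebra. Let $m^{(n)}$ be the image on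 $\Gamma^{(n)}$ of $m^{\otimes n}$ (restricted to $\widetilde{X^n}$) under $(x_1,\dots,x_n)\mapsto\{x_1,\dots,x_n\}$, and $m^{(0)}(\{\emptyset\})=1$. The Lebesgue--Poisson measure is $\lambda=\sum_{n=0}^\infty\frac1{n!}m^{(n)}$ on $\Gamma_0$. For measurable $G_1,G_2:\Gamma_0\to\mathbb{R}$, the $\ast$-convolution is $(G_1\ast G_2)(\eta)=\sum_{\xi\subset\eta}G_1(\xi)G_2(\eta\setminus\xi)$. For $C>0$, $\delta\ge0$, $\mathcal{K}_{C,\delta}$ is the Banach space of measurable functions $k:\Gamma_0\to\mathbb{R}$ (up to $\lambda$-a.e. equality) with $|k(\eta)|\le \mathrm{const}\cdot C^{|\eta|}(|\eta|!)^\delta$ for $\lambda$-a.a. $\eta$, with norm $\|k\|_{C,\delta}=\operatorname{ess\,sup}_{\eta\in\Gamma_0}\frac{|k(\eta)|}{C^{|\eta|}(|\eta|!)^\delta}$ (ess sup with respect to $\lambda$). It is known that $a\ast k\in\mathcal{K}_{C,\delta}$ for $a\in\mathcal{K}_{C_a,\delta_a}$, $k\in\mathcal{K}_{C-C_a,\delta}$, $\delta\geq\delta_a$, so $A$ is well defined. *)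

(* Defs.v *)
From HB Require Import structures.
From mathcomp Require Import all_boot all_order all_algebra.
From mathcomp Require Import finmap.
From mathcomp Require Import all_classical all_reals all_analysis.
From mathcomp Require Import measurable_realfun ess_sup_inf.

Set Implicit Arguments.
Unset Strict Implicit.
Unset Printing Implicit Defensive.

Import Order.TTheory GRing.Theory Num.Theory.
Import numFieldNormedType.Exports.

Local Open Scope classical_set_scope.
Local Open Scope ring_scope.

Section smooth.
Context {R : realType}.

(* C^k on an open set U: iterated directional derivatives of order at most k
   exist and are continuous on U. *)
Fixpoint C_k {V W : normedModType R} (k : nat) (U : set V) (f : V -> W) : Prop :=
  (forall x, U x -> {for x, continuous f}) /\
  if k is j.+1 then
    forall v, (forall x, U x -> derivable f x v) /\ C_k j U ('D_v f)
  else True.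

Definition smooth {V W : normedModType R} (U : set V) (f : V -> W) : Prop :=
  forall k, C_k k U f.

End smooth.

Record chart (R : realType) (d : nat) (X : topologicalType) := Chart {
  chart_dom : set X;
  chart_map :> X -> 'rV[R]_d;
  chart_inv : 'rV[R]_d -> X;
  chart_dom_open : open chart_dom;
  chart_cod_open : open (chart_map @` chart_dom);
  chart_mapK : {in chart_dom, cancel chart_map chart_inv};
  chart_continuous : forall x, chart_dom x -> {for x, continuous chart_map};
  chart_inv_continuous : forall y, (chart_map @` chart_dom) y ->
    {for y, continuous chart_inv}
}.

Definition transition (R : realType) (d : nat) (X : topologicalType)
  (c1 c2 : chart R d X) : 'rV[R]_d -> 'rV[R]_d := c2 \o chart_inv c1.

(* Tangent vectors are read as row vectors in chart coordinates: the transition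
   from c1 to c2 maps v to v *m 'J, so the Gram matrices G1, G2 of the metric
   in the two charts satisfy G1 = 'J *m G2 *m 'J^T. *)
Record orientedRiemannianManifold (R : realType) := OrientedRiemannianManifold {
  mfd_carrier :> ptopologicalType;
  mfd_dim : nat;
  mfd_hausdorff : hausdorff_space mfd_carrier;
  mfd_second_countable : @second_countable mfd_carrier;
  mfd_atlas : set (chart R mfd_dim mfd_carrier);
  mfd_atlas_cover : \bigcup_(c in mfd_atlas) chart_dom c = setT;
  mfd_atlas_smooth : forall c1 c2, mfd_atlas c1 -> mfd_atlas c2 ->
    smooth (c1 @` (chart_dom c1 `&` chart_dom c2)) (transition c1 c2);
  mfd_atlas_oriented : forall c1 c2, mfd_atlas c1 -> mfd_atlas c2 ->
    forall x, chart_dom c1 x -> chart_dom c2 x ->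
    0 < \det ('J (transition c1 c2) (c1 x));
  mfd_metric : chart R mfd_dim mfd_carrier -> mfd_carrier -> 'M[R]_mfd_dim;
  mfd_metric_sym : forall c x, mfd_atlas c -> chart_dom c x ->
    (mfd_metric c x)^T = mfd_metric c x;
  mfd_metric_pos : forall c x, mfd_atlas c -> chart_dom c x ->
    forall v : 'rV[R]_mfd_dim, v != 0 ->
    0 < (v *m mfd_metric c x *m v^T) ord0 ord0;
  mfd_metric_smooth : forall c, mfd_atlas c ->
    smooth (c @` chart_dom c) (mfd_metric c \o chart_inv c);
  mfd_metric_change : forall c1 c2 x, mfd_atlas c1 -> mfd_atlas c2 ->
    chart_dom c1 x -> chart_dom c2 x ->
    mfd_metric c1 x = 'J (transition c1 c2) (c1 x) *m mfd_metric c2 x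
                        *m ('J (transition c1 c2) (c1 x))^T
}.

Notation borel X := (g_sigma_algebraType (@open X)).

Section configurations.
Context {X : ptopologicalType}.

Definition offdiag n : set (n.-tuple X) := [set t | uniq t].

Definition tuple_config n (t : n.-tuple X) : {fset X} := [fset x in tval t]%fset.

(* The space of finite configurations is {fset X}: the n-point sets are the
   S_n-orbits of the n-tuples of distinct points. A set U is open in the disjoint
   union of the quotient topologies iff, for every n, its preimage among these
   tuples is open for the topology induced by the product topology on X^n. *)
Definition config_open (U : set {fset X}) : Prop := forall n,
  exists2 V : set {ptws 'I_n -> X}, open V &
    forall t, offdiag t -> U (tuple_config t) <-> V (@tnth n X t).

Lemma config_openT : config_open setT.
Proof. by move=> n; exists setT => //; exact: openT. Qed.

Lemma config_openI : setI_closed config_open.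
Proof.
move=> A B oA oB n; have [V oV VP] := oA n; have [W oW WP] := oB n.
exists (V `&` W); first exact: openI.
move=> t dt; have := VP t dt; have := WP t dt.
by rewrite /setI/=; tauto.
Qed.

Lemma config_open_bigU (I : Type) (f : I -> set {fset X}) :
  (forall i, config_open (f i)) -> config_open (\bigcup_i f i).
Proof.
move=> of_ n.
have /choice[V VP] : forall i, exists V : set {ptws 'I_n -> X}, open V /\
    forall t, offdiag t -> f i (tuple_config t) <-> V (@tnth n X t).
  by move=> i; have [V ? ?] := of_ i n; exists V.
exists (\bigcup_i V i); first by apply: bigcup_open => i _; exact: (VP i).1.
move=> t dt; split=> -[i _ h]; exists i => //; exact/((VP i).2 t dt).
Qed.

End configurations.

Definition configs (X : ptopologicalType) : Type := {fset X}.

Section configs_instances.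
Variable X : ptopologicalType.
HB.instance Definition _ := Choice.on (configs X).
HB.instance Definition _ := isPointed.Build (configs X) (fset0 : {fset X}).
HB.instance Definition _ := isOpenTopological.Build (configs X)
  (@config_openT X) (@config_openI X) (@config_open_bigU X).
HB.instance Definition _ := Measurable.copy (configs X)
  (borel (configs X)).
End configs_instances.
Section borel_tuple.
Variable X : ptopologicalType.
Hypothesis sc : @second_countable X.

Lemma countable_basis : exists2 e : nat -> set X, (forall k, open (e k)) &
  forall (x : X) (U : set X), nbhs x U -> exists k, e k x /\ e k `<=` U.
Proof.
have [B /countable_injP[f finj] [oB bB]] := sc.
pose e k := \bigcup_(A in [set A | B A /\ f A = k]) A.
exists e => [k|x U /bB[A [BA Ax] AU]].
  by apply: bigcup_open => A [/oB].
have eA : e (f A) = A.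
  apply/seteqP; split=> [y [A' [BA' fA'] A'y]|y Ay]; last by exists A.
  by rewrite -(finj A' A) ?inE.
by exists (f A); rewrite eA.
Qed.

Lemma ptws_open_box n (V : set {ptws 'I_n -> X}) (f : {ptws 'I_n -> X}) :
  open V -> V f -> exists U : 'I_n -> set X, (forall i, nbhs (f i) (U i)) /\
    (forall g : {ptws 'I_n -> X}, (forall i, U i (g i)) -> V g).
Proof.
move=> oV Vf.
pose F : set_system {ptws 'I_n -> X} :=
  filter_from [set U : 'I_n -> set X | forall i, nbhs (f i) (U i)]
    (fun U => [set g | forall i, U i (g i)]).
have FF : Filter F.
  apply: filter_from_filter; first by exists (fun=> setT) => i; exact: filterT.
  move=> U1 U2 h1 h2; exists (fun i => U1 i `&` U2 i) => /= [i|g h].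
    by apply: filterI; [exact: h1|exact: h2].
  by split=> i; have [] := h i.
have : F --> f.
  apply/cvg_sup => i A [_ [[C oC <-] Cf CA]].
  exists (fun j => if j == i then C else setT) => /= [j|g /(_ i)].
    by case: eqP => [->|_]; [exact: open_nbhs_nbhs|exact: filterT].
  by rewrite eqxx => Cg; exact: CA.
move=> /(_ V) []; first exact: open_nbhs_nbhs.
by move=> U h1 h2; exists U.
Qed.

Let Y : measurableType _ := borel X.

Lemma measurable_box n (U : 'I_n -> set X) : (forall i, open (U i)) ->
  measurable [set t : n.-tuple Y | forall i, U i (tnth t i)].
Proof.
move=> oU.
rewrite (_ : mkset _ =
    \bigcap_(i in [set: 'I_n]) ((fun t : n.-tuple Y => tnth t i) @^-1` U i)).
  apply: fin_bigcap_measurable => // i _.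
  rewrite -[X in measurable X]setTI; apply: measurable_tnth => //.
  exact: sub_sigma_algebra.
by apply/seteqP; split => [t h i _|t h i]; exact: h.
Qed.

Lemma measurable_ptws_open n (V : set {ptws 'I_n -> X}) : open V ->
  measurable [set t : n.-tuple Y | V (@tnth n X t)].
Proof.
move=> oV; have [e oe eP] := countable_basis.
rewrite (_ : mkset _ = \bigcup_(u : {ffun 'I_n -> nat})
   [set t : n.-tuple Y | (forall i, e (u i) (tnth t i)) /\
     (forall g : {ptws 'I_n -> X}, (forall i, e (u i) (g i)) -> V g)]).
  apply: (@countable_bigcupT_measurable _ (n.-tuple Y) {ffun 'I_n -> nat}).
    exact: countableP.
  move=> u.
  have [uV|uV] := pselect
      (forall g : {ptws 'I_n -> X}, (forall i, e (u i) (g i)) -> V g).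
    rewrite (_ : mkset _ = [set t : n.-tuple Y | forall i, e (u i) (tnth t i)]).
      exact: (@measurable_box n (fun i => e (u i))).

    by apply/seteqP; split=> t //= -[].
  by rewrite (_ : mkset _ = set0)//; apply/seteqP; split=> t //= -[].
apply/seteqP; split=> [t /= Vt|t [u _ [h1 h2]]]; last exact: h2.
have [U [nU UV]] := ptws_open_box oV Vt.
have /choice[u uP] : forall i, exists k, e k (tnth t i) /\ e k `<=` U i.
  by move=> i; exact: eP.
exists [ffun i => u i] => //; split=> [i|g h].
  by rewrite ffunE; exact: (uP i).1.
by apply: UV => i; apply: (uP i).2; have := h i; rewrite ffunE.
Qed.

Hypothesis hX : hausdorff_space X.

Lemma measurable_offdiag n : measurable (@offdiag X n : set (n.-tuple Y)).
Proof.
have [e oe eP] := countable_basis.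
pose D (i j : 'I_n) : set (n.-tuple Y) := [set t | tnth t i != tnth t j].
rewrite (_ : @offdiag X n = \bigcap_(p in [set p : 'I_n * 'I_n | p.1 != p.2])
    D p.1 p.2); last first.
  apply/seteqP; split=> [t ut [i j] /= ij|t h].
    by apply: contra ij => /eqP/(tuple_uniqP _ ut) ->.
  apply/tuple_uniqP => i j tij; apply/eqP/negPn/negP => ij.
  by have := h (i, j) ij; rewrite /D/= tij eqxx.
apply: fin_bigcap_measurable; first exact: finite_finset.
move=> [i j] /= ij.
rewrite (_ : D i j = \bigcup_(k in [set k : nat * nat | e k.1 `&` e k.2 = set0])
    ((fun t => tnth t i) @^-1` e k.1 `&` (fun t => tnth t j) @^-1` e k.2)).
  rewrite bigcup_mkcond.
  apply: (@countable_bigcupT_measurable _ (n.-tuple Y) (nat * nat)%type); first exact: countableP.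
  move=> k.
  case: ifP => // _; apply: measurableI; rewrite -[X in measurable X]setTI;
    by apply: measurable_tnth => //; exact: sub_sigma_algebra.
apply/seteqP; split=> [t|t [[k l] /= kl [tk tl]]]; last first.
  apply/eqP => tij; have : (e k `&` e l) (tnth t i) by split => //; rewrite tij.
  by rewrite kl.
have := hX; rewrite open_hausdorff => hX' /= tij.
have [[A B] /= [Ai Bj] [oA oB AB]] := hX' _ _ tij.
rewrite !inE in Ai Bj.
have [k [ki kA]] := eP _ _ (open_nbhs_nbhs (conj oA Ai)).
have [l [lj lB]] := eP _ _ (open_nbhs_nbhs (conj oB Bj)).
exists (k, l) => //=; apply/seteqP; split=> //; rewrite -(eqP AB).
by move=> y [/kA ? /lB ?]; split.
Qed.

Lemma measurable_tuple_config n :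
  measurable_fun (@offdiag X n : set (n.-tuple Y))
    (@tuple_config X n : n.-tuple Y -> configs X).
Proof.
apply: (@measurability _ _ _ _ _ _ (@open (configs X))) => //.
move=> _ [A oA <-]; have [V oV VP] := oA n.
rewrite (_ : _ `&` _ = @offdiag X n `&` [set t : n.-tuple Y | V (@tnth n X t)]).
  by apply: measurableI; [exact: measurable_offdiag|exact: measurable_ptws_open].
by apply/seteqP; split=> t [dt h]; split => //; exact/(VP t dt).
Qed.

End borel_tuple.
Section image_measure.
Local Open Scope ereal_scope.
Context d1 d2 (T1 : measurableType d1) (T2 : measurableType d2) (R : realType).
Variables (mu : {measure set T1 -> \bar R}) (D : set T1) (f : T1 -> T2).
Hypotheses (mD : measurable D) (mf : measurable_fun D f).

(* image under f of the restriction of mu to D *)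
Definition image_measure & measurable D & measurable_fun D f : set T2 -> \bar R :=
  fun A => mu (D `&` f @^-1` A).

Local Notation im := (image_measure mD mf).

Let im0 : im set0 = 0.
Proof. by rewrite /image_measure preimage_set0 setI0 measure0. Qed.

Let im_ge0 A : 0 <= im A.
Proof. exact: measure_ge0. Qed.

Let im_sigma_additive : semi_sigma_additive im.
Proof.
move=> F mF tF mUF; rewrite /image_measure preimage_bigcup setI_bigcupr.
apply: measure_semi_sigma_additive.
- by move=> n; exact: mf.
- apply/trivIsetP => i j _ _ ij; apply/seteqP; split=> // x [[_ Fi] [_ Fj]].
  move/trivIsetP : tF => /(_ i j Logic.I Logic.I ij) Fij.
  by have : (F i `&` F j) (f x) by []; rewrite Fij.
- by rewrite -setI_bigcupr -preimage_bigcup; exact: mf.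
Qed.

HB.instance Definition _ := isMeasure.Build _ _ _ im im0 im_ge0 im_sigma_additive.

End image_measure.

Section lebesgue_poisson.
Context {R : realType} {X : orientedRiemannianManifold R}.
Variable m : {sigma_finite_measure set (borel X) -> \bar R}.

Definition tuple_rcons n (p : n.-tuple (borel X) * borel X) :
  n.+1.-tuple (borel X) := [tuple of p.2 :: p.1].

Let measurable_tuple_rcons n : measurable_fun [set: _] (@tuple_rcons n).
Proof. exact: measurable_cons. Qed.

(* The n-fold product of m; sigma-finiteness of m is what the library's product
   measure requires, and holds for any Radon measure on an exhausted space. *)
Fixpoint power_measure n : {measure set (n.-tuple (borel X)) -> \bar R} :=
  if n is k.+1 return {measure set (n.-tuple (borel X)) -> \bar R} then
    image_measure (power_measure k \x m)%E measurableT (@measurable_tuple_rcons k)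
  else \d_ [tuple].

Definition config_measure n : {measure set (configs X) -> \bar R} :=
  image_measure (power_measure n)
    (@measurable_offdiag X (mfd_second_countable X) (@mfd_hausdorff R X) n)
    (@measurable_tuple_config X (mfd_second_countable X) (@mfd_hausdorff R X) n).

Definition lebesgue_poisson : {measure set (configs X) -> \bar R} :=
  mseries (fun n => mscale ((n`!)%:R^-1)%:nng (config_measure n)) 0.

Lemma lebesgue_poisson_gt0 : (0 < lebesgue_poisson setT)%E.
Proof.
rewrite /lebesgue_poisson /= /mseries.
rewrite (@lt_le_trans _ _ (mscale ((0`!)%:R^-1)%:nng (config_measure 0) setT))//.
  rewrite /mscale/= /image_measure /= preimage_setT setIT diracE mem_set//.
  by rewrite mule1 lte_fin invr_gt0.
rewrite (nneseries_split 0 1)//= add0n big_nat1 leeDl//.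
by apply: nneseries_ge0.
Qed.

End lebesgue_poisson.

Section growth_space.
Context {R : realType} {X : orientedRiemannianManifold R}.
Variable m : {sigma_finite_measure set (borel X) -> \bar R}.
Local Notation lambda := (lebesgue_poisson m).

Definition growth (C delta : R) (eta : configs X) : R :=
  C ^+ #|` eta| * ((#|` eta|)`!%:R `^ delta).

Definition growth_bounded (C delta : R) : set (configs X -> R) :=
  [set k : configs X -> R | measurable_fun setT k /\
    exists c : R, \forall eta \ae lambda, `|k eta| <= c * growth C delta eta].

Section quotient.
Variables (C : {posnum R}) (delta : R).

Lemma growth_gt0 eta : 0 < growth C%:num delta eta.
Proof. by rewrite mulr_gt0 ?exprn_gt0// powR_gt0// ltr0n fact_gt0. Qed.

Definition growth_fun : {pred (configs X -> R)} :=
  fun k => `[< growth_bounded C%:num delta k >].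

Lemma growth_fun_submod_closed : submod_closed growth_fun.
Proof.
split.
  apply/asboolP; split; first exact: measurable_cst.
  by exists 0; apply: aeW => eta; rewrite mul0r normr0.
move=> a f g /asboolP[mf [c fc]] /asboolP[mg [d gd]]; apply/asboolP; split.
  by apply: measurable_funD => //; exact: measurable_funM.
exists (`|a| * c + d); move: fc gd; apply: filterS2 => eta fc gd.
rewrite mulrDl (le_trans (ler_normD _ _))// lerD//.
by rewrite normrM -mulrA ler_wpM2l.
Qed.

HB.instance Definition _ := GRing.isSubmodClosed.Build _ _ growth_fun
  growth_fun_submod_closed.

Record growth_funType := GrowthFun {
  growth_val :> configs X -> R; growth_valP : growth_val \in growth_fun }.
HB.instance Definition _ := [isSub for growth_val].
HB.instance Definition _ := [Choice of growth_funType by <:].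
HB.instance Definition _ := [SubChoice_isSubLmodule of growth_funType by <:].

(* growth_space is the space K_(C, delta): growth_bounded functions modulo
   lambda-almost everywhere equality, normed by the weighted essential supremum. *)
Definition growth_null : {pred growth_funType} :=
  fun k => `[< \forall eta \ae lambda, k eta = 0 >].

Lemma growth_null_zmod_closed : zmod_closed growth_null.
Proof.
split; first exact/asboolP/aeW.
move=> f g /asboolP f0 /asboolP g0; apply/asboolP.
move: f0 g0; apply: filterS2 => eta f0 g0.
by rewrite -[LHS]/(f eta - g eta) f0 g0 subr0.
Qed.

HB.instance Definition _ := GRing.isZmodClosed.Build _ growth_null
  growth_null_zmod_closed.

Definition growth_space : Type := (Quotient.quot growth_null).
HB.instance Definition _ := GRing.Zmodule.on growth_space.

Definition growth_class (f : growth_funType) : growth_space :=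
  \pi_(Quotient.quot growth_null)%qT f.

Definition growth_repr (k : growth_space) : growth_funType :=
  (repr : (Quotient.quot growth_null) -> growth_funType) k.

Definition growth_space_fun (k : growth_space) : configs X -> R := growth_repr k.

Coercion growth_space_fun : growth_space >-> Funclass.
Lemma growth_reprK : cancel growth_repr growth_class.
Proof. exact: reprK. Qed.

Lemma growth_class_eq (f g : growth_funType) :
  growth_class f = growth_class g <->
  \forall eta \ae lambda, (f : configs X -> R) eta = g eta.
Proof.
rewrite (rwP eqP) -[_ == _]/(f == g %[mod (Quotient.quot growth_null)])%qT.
rewrite -Quotient.idealrBE; split=> [/asboolP h|h].
  apply: filterS h => eta; rewrite -[growth_val _ _]/(f eta - g eta).
  by move/eqP; rewrite subr_eq0 => /eqP.
apply/asboolP; apply: filterS h => eta fg.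
by rewrite -[growth_val _ _]/(f eta - g eta) fg subrr.
Qed.

Lemma growth_classK (f : growth_funType) :
  \forall eta \ae lambda, growth_class f eta = f eta.
Proof. by apply/growth_class_eq; exact: growth_reprK. Qed.

Lemma growth_classD : {morph growth_class : f g / f + g}.
Proof. exact: Quotient.pi_add. Qed.

Definition growth_scale (c : R) (k : growth_space) : growth_space :=
  growth_class (c *: growth_repr k).

Lemma growth_classZ c f : growth_class (c *: f) = growth_scale c (growth_class f).
Proof.
apply/growth_class_eq; apply: filterS (growth_classK f) => eta kf.
by rewrite -[LHS]/(c * f eta) -kf.
Qed.

Let scaleA a b v : growth_scale a (growth_scale b v) = growth_scale (a * b) v.
Proof. by rewrite -[v]growth_reprK -!growth_classZ scalerA. Qed.

Let scale1 : left_id 1 growth_scale.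
Proof. by move=> v; rewrite -[v]growth_reprK -growth_classZ scale1r. Qed.

Let scaleDr : right_distributive growth_scale +%R.
Proof.
move=> c u v; rewrite -[u]growth_reprK -[v]growth_reprK.
by rewrite -growth_classD -!growth_classZ -growth_classD scalerDr.
Qed.

Let scaleDl v : {morph growth_scale^~ v : a b / a + b}.
Proof.
move=> a b; rewrite -[v]growth_reprK.
by rewrite -!growth_classZ -growth_classD scalerDl.
Qed.

HB.instance Definition _ := GRing.Zmodule_isLmodule.Build R growth_space
  scaleA scale1 scaleDr scaleDl.

Definition growth_ess_sup (f : configs X -> R) : \bar R :=
  ess_sup lambda (fun eta => (`|f eta| / growth C%:num delta eta)%:E).

Definition growth_norm (k : growth_space) : R := fine (growth_ess_sup k).

Let ess_sup_fin (k : growth_space) : growth_ess_sup k \is a fin_num.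
Proof.
have /asboolP[_ [c kc]] := growth_valP (growth_repr k).
rewrite ge0_fin_numE.
  apply: (@le_lt_trans _ _ c%:E); last exact: ltry.
  apply/ess_supP; apply: filterS kc => eta.
  by rewrite lee_fin ler_pdivrMr// growth_gt0.
apply: ess_sup_gee; first exact: lebesgue_poisson_gt0.
by apply: aeW => eta; rewrite lee_fin divr_ge0// ltW// growth_gt0.
Qed.

Let normE (k : growth_space) (f : configs X -> R) :
  (\forall eta \ae lambda, k eta = f eta) -> (growth_norm k)%:E = growth_ess_sup f.
Proof.
move=> kf; rewrite fineK//; apply: eq_ess_sup.
by apply: filterS kf => eta ->.
Qed.

Let add_ae (u v : growth_space) :
  \forall eta \ae lambda, growth_space_fun (u + v) eta = u eta + v eta.
Proof.
have -> : u + v = growth_class (growth_repr u + growth_repr v).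
  by rewrite growth_classD !growth_reprK.
exact: growth_classK.
Qed.

Let ler_normD (u v : growth_space) : growth_norm (u + v) <= growth_norm u + growth_norm v.
Proof.
rewrite -lee_fin EFinD (normE (add_ae u v)) !fineK//.
rewrite (le_trans _ (ess_supD _ _ _))// le_ess_sup//; apply: aeW => eta.
rewrite lee_fin -mulrDl ler_wpM2r ?invr_ge0 ?ler_normD//.
by rewrite ltW// growth_gt0.
Qed.

Let normZ c (u : growth_space) : growth_norm (c *: u) = `|c| * growth_norm u.
Proof.
apply: EFin_inj.
rewrite (normE (growth_classK (c *: growth_repr u))) EFinM fineK//.
rewrite -ess_supZl ?lebesgue_poisson_gt0//; apply: eq_ess_sup; apply: aeW => eta.
by rewrite -[growth_val _ _]/(c * u eta) normrM -mulrA.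
Qed.

Let norm_eq0 (u : growth_space) : growth_norm u = 0 -> u = 0.
Proof.
move=> u0.
have <- : growth_class 0 = 0.
  by apply: (addrI (growth_class 0)); rewrite -growth_classD !addr0.
rewrite -[u]growth_reprK.
apply/growth_class_eq.
have : (growth_ess_sup u <= 0)%E.
  by rewrite -(normE (aeW lambda (fun eta => erefl (u eta)))) u0.
move/ess_supP; apply: filterS => eta.
rewrite lee_fin pmulr_lle0 ?invr_gt0 ?growth_gt0// normr_le0 => /eqP.
exact.
Qed.

HB.instance Definition _ := Lmodule_isNormed.Build R growth_space
  ler_normD normZ norm_eq0.

End quotient.
End growth_space.


Section convolution.
Context {R : realType} {X : orientedRiemannianManifold R}.

Definition conv (G1 G2 : configs X -> R) (eta : configs X) : R :=
  \sum_(xi <- fpowerset eta) G1 xi * G2 (eta `\` xi)%fset.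

Variable m : {sigma_finite_measure set (borel X) -> \bar R}.
Local Notation lambda := (lebesgue_poisson m).
Variables (Ca C : {posnum R}) (deltaa delta : R).

(* the subspace K_(C - Ca, delta) of K_(C, delta) *)
Definition conv_dom : set (growth_space m C delta) :=
  [set k | growth_bounded m (C%:num - Ca%:num) delta k].

(* The class of the function conv a k. For 0 <= deltaa <= delta and k in conv_dom
   this function is measurable and growth_bounded, so the class exists and is
   unique; only those k matter, and the default value of get is never used. *)
Definition conv_op (a : growth_space m Ca deltaa) (k : growth_space m C delta) :
    growth_space m C delta :=
  get [set g : growth_space m C delta |
    \forall eta \ae lambda, (g : configs X -> R) eta = conv a k eta].

End convolution.
Arguments conv_dom {R X} m Ca C delta.
Arguments conv_op {R X m Ca C deltaa delta} a k.

Section closable.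
Context {R : realType} {V : normedModType R}.
Implicit Types (D : set V) (T : V -> V).

Definition linear_operator D T : Prop :=
  D 0 /\ forall (c : R) u v, D u -> D v ->
    D (c *: u + v) /\ T (c *: u + v) = c *: T u + T v.

Definition operator_graph D T : set (V * V) := [set p | D p.1 /\ p.2 = T p.1].

Definition closed_operator D T : Prop :=
  linear_operator D T /\ closed (operator_graph D T).

Definition closable D T : Prop := exists (D' : set V) (T' : V -> V),
  [/\ closed_operator D' T', D `<=` D' & forall u, D u -> T' u = T u].

End closable.

(* Main.v *)
Require Import Defs.
From mathcomp Require Import all_boot all_order all_algebra.
From mathcomp Require Import finmap.
From mathcomp Require Import all_classical all_reals all_analysis.
From mathcomp Require Import measurable_realfun ess_sup_inf.

Set Implicit Arguments.
Unset Strict Implicit.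
Unset Printing Implicit Defensive.

Import Order.TTheory GRing.Theory Num.Theory.
Import numFieldNormedType.Exports.

Local Open Scope classical_set_scope.
Local Open Scope ring_scope.

(** The operator is closable because it is a restriction of the maximal
    convolution operator, with domain all k in K_(C, delta) for which conv a k
    lies again in K_(C, delta), and the maximal operator is closed.

    The value of conv a k at eta is a finite sum of terms that involve k only at
    subsets of eta. Let u_n tend to k in K_(C, delta), with u_n in the maximal
    domain and conv a u_n tending to g. The norm controls the values almost
    everywhere, so there is a null set N of configurations outside of which
    u_n tends to k pointwise and conv a u_n tends to g pointwise. At every eta
    with no subset in N, conv a u_n also tends to conv a k, hence
    g = conv a k there. What makes this an almost-everywhere identity is that the
    configurations having a subset in N again form a null set
    (negligible_superconfigs). The same fact makes conv a k independent, up to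
    null sets, of the representative of k, which gives linearity.

    To prove that fact, one works on n-tuples: a subset of {x_1, ..., x_n} is obtained
    by selecting coordinates with a boolean mask, and the preimage of a null set
    of X^k under a coordinate projection X^n -> X^k is null (null_seqs_mask, by
    induction on the mask, one section at a time).

    It remains that the maximal domain contains K_(C - Ca, delta). The bound is
    the binomial formula, together with p! q! <= (p + q)! (conv_growth_le).
    Measurability of the convolution (measurable_conv) is a local matter: if
    U_1, ..., U_n are pairwise disjoint open sets, then on the open set of those
    eta with exactly one point in each U_i and no other point, the subsets of eta
    are its intersections with the sets U_I, the union of the U_i with i in I, and
    taking the intersection of eta with U_I is measurable there. Countably many
    such open sets cover the space of configurations. *)

(* conv is the convolution of functions of finite configurations, not the convex
   combination of the same name. *)
Local Notation conv := Defs.conv.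

(** * Sums over the subsets of a finite set *)

Section finite_subsets.
Variable K : choiceType.

(** The set of those entries of t whose index is in I. *)
Definition subconfig n (t : n.-tuple K) (I : {set 'I_n}) : {fset K} :=
  [fset tnth t i | i in I]%fset.

Lemma mem_subconfig n (t : n.-tuple K) (I : {set 'I_n}) i : uniq t ->
  (tnth t i \in subconfig t I) = (i \in I).
Proof.
move=> ut; apply/imfsetP/idP => [[j /= jI]|iI]; last by exists i.
by move/(tuple_uniqP _ ut) => ->.
Qed.

Lemma fsub_tuple n (t : n.-tuple K) (xi : {fset K}) :
  (xi `<=` [fset x in tval t])%fset ->
  xi = subconfig t [set i | tnth t i \in xi]%SET.
Proof.
move=> /fsubsetP sub; apply/fsetP => x; apply/idP/imfsetP => /= [xxi|[i]].
  have /[!inE] /tnthP[i xE] := sub x xxi.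
  by exists i => //; rewrite inE -xE.
by rewrite inE => ? ->.
Qed.

Lemma subconfigD n (t : n.-tuple K) (I : {set 'I_n}) : uniq t ->
  ([fset x in tval t] `\` subconfig t I)%fset = subconfig t (~: I).
Proof.
move=> ut; apply/fsetP => x; rewrite !inE.
apply/andP/imfsetP => /= [[nI /tnthP[i xE]]|[i]].
  by exists i; rewrite // inE -(mem_subconfig I i ut) -xE.
by rewrite inE => iI ->; rewrite mem_subconfig// iI mem_tnth.
Qed.

Lemma card_subconfig n (t : n.-tuple K) (I : {set 'I_n}) : uniq t ->
  #|` subconfig t I| = #|I|.
Proof.
by move=> ut; rewrite card_imfset//= ?cardE//; exact/tuple_uniqP.
Qed.

Lemma sum_fpowerset_tuple (M : nmodType) n (t : n.-tuple K)
    (F : {fset K} -> M) : uniq t ->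
  \sum_(xi <- fpowerset [fset x in tval t]%fset) F xi =
  \sum_(I : {set 'I_n}) F (subconfig t I).
Proof.
move=> ut; rewrite -[RHS]big_enum /= -(big_map (subconfig t) predT F).
apply/perm_big/uniq_perm; first exact: fset_uniq.
  rewrite map_inj_in_uniq ?enum_uniq// => I J _ _ IJ.
  by apply/setP => i; rewrite -(mem_subconfig I i ut) IJ mem_subconfig.
move=> xi; rewrite fpowersetE; apply/idP/mapP => [sub|[I _ ->]].
  by exists [set i | tnth t i \in xi]%SET; [rewrite mem_enum|exact: fsub_tuple].
by apply/fsubsetP => x /imfsetP[i _ ->]; rewrite inE mem_tnth.
Qed.

Lemma tuple_of_fset (eta : {fset K}) : exists t : #|` eta|.-tuple K,
  uniq t /\ [fset x in tval t]%fset = eta.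
Proof.
exists (in_tuple eta); split; first exact: fset_uniq.
by apply/fsetP => x; rewrite inE.
Qed.

Lemma sum_fpowerset_binomial (S : comRingType) (x y : S) (eta : {fset K}) :
  \sum_(xi <- fpowerset eta) x ^+ #|` xi| * y ^+ #|` eta `\` xi|%fset =
  (x + y) ^+ #|` eta|.
Proof.
have [t [ut tE]] := tuple_of_fset eta.
move: (#|` eta|) t ut tE => n t ut <-.
rewrite sum_fpowerset_tuple//.
rewrite (partition_big (fun I : {set 'I_n} => inord #|I| : 'I_n.+1) xpredT)//=.
rewrite addrC exprDn; apply: eq_bigr => k _.
rewrite (eq_bigr (fun=> y ^+ (n - k) * x ^+ k)); last first.
  move=> I; rewrite subconfigD// !card_subconfig// => /eqP <-.
  rewrite inordK ?ltnS; last by rewrite -[leqRHS]card_ord max_card.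
  by rewrite (cardsCs (~: I)) finset.setCK card_ord mulrC.
rewrite sumr_const; congr (_ *+ _).
have := card_draws 'I_n k; rewrite card_ord => <-; rewrite -[LHS]cardsE.
apply/eq_card => I; rewrite inE [RHS]inE unfold_in eqnE /= inordK//.
by rewrite ltnS -[leqRHS]card_ord max_card.
Qed.

End finite_subsets.

(** * Measurability of the convolution *)

Section config_measurability.
Variable X : ptopologicalType.
Implicit Types (U V : set X) (eta : configs X).

(** A set of functions on a finite set is open for pointwise convergence as soon
    as it contains a box of neighbourhoods around each of its points. *)
Lemma ptws_box_open n (V : set {ptws 'I_n -> X}) :
  (forall f, V f -> exists U : 'I_n -> set X, (forall i, nbhs (f i) (U i)) /\
    (forall g : {ptws 'I_n -> X}, (forall i, U i (g i)) -> V g)) -> open V.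
Proof.
move=> VP; rewrite openE => f Vf; have [U [nU UV]] := VP f Vf.
apply: (@filterS _ (nbhs f) _
  [set g : {ptws 'I_n -> X} | forall i, U i (g i)]) => //.
apply: (@filter_forall {ptws 'I_n -> X} 'I_n (fun i g => U i (g i)) (nbhs f)).
move=> i.
exact: (@proj_continuous 'I_n (fun=> X) i f (U i) (nU i)).
Qed.

(** The part of eta that lies in U. *)
Definition config_restr U eta : configs X := [fset x in eta | `[< U x >]]%fset.

Lemma measurable_config_open (W : set (configs X)) :
  config_open W -> measurable W.
Proof. exact: sub_sigma_algebra. Qed.

(** Among the configurations contained in the disjoint union of the open sets U
    and V, restriction to U is continuous: points cannot leave U without
    entering V. *)
Lemma config_restr_open U V (W : set (configs X)) : open U -> open V ->
  U `&` V = set0 -> config_open W ->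
  config_open ([set eta : configs X | forall x, x \in eta -> (U `|` V) x] `&`
    config_restr U @^-1` W).
Proof.
move=> oU oV UV0 oW n.
have [Q QP] : exists Q : forall k, set {ptws 'I_k -> X}, forall k, open (Q k) /\
    forall t : k.-tuple X, offdiag t -> W (tuple_config t) <-> Q k (@tnth k X t).
  exists (fun k => sval (cid2 (oW k))) => k.
  by case: (cid2 (oW k)).
(* J is the set of the indices of the points in U *)
pose sel (J : {set 'I_n}) (f : 'I_n -> X) : 'I_#|J| -> X :=
  fun j => f (enum_val j).
exists [set f | exists J : {set 'I_n}, [/\ forall i, i \in J -> U (f i),
    forall i, i \notin J -> V (f i) & Q #|J| (sel J f)]].
  apply: ptws_box_open => f [J [JU JV]].
  have [oOJ _] := QP #|J|; move=> /(ptws_open_box oOJ)[B [nB BQ]].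
  exists (fun i => (if i \in J then U else V) `&`
     [set x | forall j, enum_val j == i -> B j x]); split => [i|g gP].
    apply: filterI.
      by apply: open_nbhs_nbhs; case: ifPn => iJ; split => //; auto.
    apply: (@filter_forall X _ (fun j => [set x | enum_val j == i -> B j x])).
    move=> j; case: eqP => [<-|_]; first by apply: filterS (nB j) => x Bx _.
    exact: nearW.
  exists J; split=> [i iJ|i iJ|].
  - by have [] := gP i; rewrite iJ.
  - by have [] := gP i; rewrite (negbTE iJ).
  - by apply: BQ => j; have [_] := gP (enum_val j); apply.
move=> t ut.
have selE (J : {set 'I_n}) : (forall i, i \in J -> U (tnth t i)) ->
    (forall i, i \notin J -> V (tnth t i)) ->
    W (config_restr U (tuple_config t)) <-> Q #|J| (sel J (@tnth n X t)).
  move=> JU JV.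
  have [s sE] : exists s : #|J|.-tuple X, forall j, tnth s j = tnth t (enum_val j).
    exists [tuple tnth t (enum_val j) | j < #|J|] => j.
    by rewrite tnth_mktuple.
  have us : offdiag s.
    apply/tuple_uniqP => i j; rewrite !sE.
    by move=> /(tuple_uniqP _ ut)/enum_val_inj.
  have -> : config_restr U (tuple_config t) = tuple_config s.
    apply/fsetP => x; rewrite !inE /=; apply/andP/tnthP => [[]|[j ->]].
      rewrite inE => /tnthP[i ->] Ui.
      have iJ : i \in J.
        apply/negPn/negP => /JV Vi.
        have : (U `&` V) (tnth t i) by [].
        by rewrite UV0.
      by exists (enum_rank_in iJ i); rewrite sE enum_rankK_in.
    rewrite sE inE mem_tnth; split => //.
    exact/JU/enum_valP.
  have [_ ->//] := QP #|J|.
  suff -> : (@tnth _ X s : {ptws _ -> X}) = sel J (@tnth n X t) by [].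
  by apply/funext => j; rewrite sE.
split=> [[tUV Wt]|[J [JU JV]]].
  exists [set i | `[< U (tnth t i) >]]%SET.
  have JU i : i \in [set i | `[< U (tnth t i) >]]%SET -> U (tnth t i).
    by rewrite inE => /asboolP.
  have JV i : i \notin [set i | `[< U (tnth t i) >]]%SET -> V (tnth t i).
    rewrite inE => /asboolP nU.
    by case: (tUV (tnth t i)) => //; rewrite inE mem_tnth.
  by split => //; apply/selE.
move=> /selE WU; split; last exact: WU.
move=> x; rewrite inE => /tnthP[i ->].
by case: (boolP (i \in J)) => [/JU|/JV]; [left|right].
Qed.

Lemma measurable_config_restr U V : open U -> open V -> U `&` V = set0 ->
  measurable_fun [set eta : configs X | forall x, x \in eta -> (U `|` V) x]
    (config_restr U).
Proof.
move=> oU oV UV0.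
apply: (@measurability _ _ _ _ _ _ (@open (configs X))) => //.
move=> _ [A oA <-]; apply: measurable_config_open.
exact: config_restr_open.
Qed.

(** The configurations made of n points, one in each U i; when the U i are
    pairwise disjoint the tuple t is determined by the configuration. *)
Definition one_point_each n (U : 'I_n -> set X) : set (configs X) :=
  [set eta | exists2 t : n.-tuple X, eta = tuple_config t &
     forall i, U i (tnth t i)].

(** Members with distinct indices are disjoint. *)
Definition pairwise_disjoint n (U : 'I_n -> set X) :=
  forall i j, i != j -> U i `&` U j = set0.

Lemma pairwise_disjoint_uniq n (U : 'I_n -> set X) (t : n.-tuple X) :
  pairwise_disjoint U -> (forall i, U i (tnth t i)) -> uniq t.
Proof.
move=> U0 tU; apply/tuple_uniqP => i j tij; apply/eqP/negPn/negP => ij.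
have : (U i `&` U j) (tnth t i) by split; rewrite // tij.
by rewrite (U0 _ _ ij).
Qed.

Lemma one_point_each_open n (U : 'I_n -> set X) : (forall i, open (U i)) ->
  pairwise_disjoint U -> config_open (one_point_each U).
Proof.
move=> oU U0 k.
exists [set f | exists2 tau : 'I_k -> 'I_n, bijective tau &
    forall j, U (tau j) (f j)].
  apply: ptws_box_open => f [tau btau tauU]; exists (U \o tau); split=> [j|g gU].
    by apply: open_nbhs_nbhs; split; [exact: oU|exact: tauU].
  by exists tau.
move=> s us; split=> [[t st tU]|[tau [sigma tauK sigmaK] tauU]].
  have ut := pairwise_disjoint_uniq U0 tU.
  have /choice[tau tauE] : forall j, exists i, tnth s j = tnth t i.
    move=> j; apply/tnthP; move/fsetP : st => /(_ (tnth s j)).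
    by rewrite !inE mem_tnth => <-.
  have /choice[sigma sigmaE] : forall i, exists j, tnth t i = tnth s j.
    move=> i; apply/tnthP; move/fsetP : st => /(_ (tnth t i)).
    by rewrite !inE mem_tnth => ->.
  exists tau; last by move=> j; rewrite tauE.
  exists sigma => [j|i].
    by apply: (tuple_uniqP _ us); rewrite -sigmaE -tauE.
  by apply: (tuple_uniqP _ ut); rewrite -tauE -sigmaE.
exists [tuple tnth s (sigma i) | i < n]; last first.
  by move=> i; rewrite tnth_mktuple -{1}(sigmaK i).
apply/fsetP => x; rewrite !inE; apply/tnthP/tnthP => -[i ->].
  by exists (tau i); rewrite tnth_mktuple tauK.
by rewrite tnth_mktuple; exists (sigma i).
Qed.

Lemma config_restr_subconfig n (U : 'I_n -> set X) (t : n.-tuple X)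
    (I : {set 'I_n}) :
  pairwise_disjoint U -> (forall i, U i (tnth t i)) ->
  config_restr (\bigcup_(i in [set` I]) U i) (tuple_config t) = subconfig t I.
Proof.
move=> U0 tU; have ut := pairwise_disjoint_uniq U0 tU.
apply/fsetP => x; apply/idP/imfsetP => /= [|[i iI ->]].
  rewrite !inE => /andP[/tnthP[i ->] /asboolP[j /= jI Uj]].
  exists i => //; suff -> : i = j by [].
  apply/eqP/negPn/negP => ij.
  have : (U i `&` U j) (tnth t i) by [].
  by rewrite (U0 _ _ ij).
rewrite !inE mem_tnth /=; apply/asboolP.
by exists i.
Qed.

Hypotheses (sc : @second_countable X) (hX : hausdorff_space X).

(** In a Hausdorff space with a countable basis, the points of a configuration are
    separated by pairwise disjoint basic open sets, so countably many of the sets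
    one_point_each U cover the configurations. *)
Lemma one_point_each_cover : exists e : nat -> set X, (forall k, open (e k)) /\
  forall eta : configs X, exists (n : nat) (u : {ffun 'I_n -> nat}),
    pairwise_disjoint (e \o u) /\ one_point_each (e \o u) eta.
Proof.
have [e oe eP] := countable_basis sc; exists e; split=> // eta.
have [t [ut tE]] := tuple_of_fset eta.
move: (#|` eta|) t ut tE => n t ut tE; exists n.
(* W (i, j) separates the points i and j of t *)
have /choice[W WP] : forall p : 'I_n * 'I_n, exists W : set X * set X,
    p.1 != p.2 -> [/\ open W.1, open W.2, W.1 (tnth t p.1), W.2 (tnth t p.2) &
      W.1 `&` W.2 = set0].
  move=> [i j] /=; have [eij|ij] := eqVneq i j; first by exists (set0, set0).
  have tij : tnth t i != tnth t j.
    by apply: contra ij => /eqP/(tuple_uniqP _ ut) ->.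
  have := hX; rewrite open_hausdorff => /(_ _ _ tij)[[A B] /= [Ai Bj] [oA oB AB]].
  exists (A, B) => _; split=> //=; [by rewrite inE in Ai|by rewrite inE in Bj|].
  exact/eqP.
have /choice[u uP] : forall i, exists k, e k (tnth t i) /\ e k `<=`
    [set x | forall j, i != j -> (W (i, j)).1 x /\ (W (j, i)).2 x].
  move=> i; apply: eP.
  apply: (@filter_forall X _ (fun j => [set x | i != j -> (W (i, j)).1 x /\
    (W (j, i)).2 x])) => j.
  have [eij|ij] := eqVneq i j; first exact: nearW.
  have [V1 _ w1 _ _] := WP (i, j) ij.
  have [|_ V2 _ w2 _] := WP (j, i); first by rewrite eq_sym.
  have n1 := open_nbhs_nbhs (conj V1 w1).
  have n2 := open_nbhs_nbhs (conj V2 w2).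
  by apply: filterS2 n1 n2.
exists [ffun i => u i]; split; last first.
  by exists t => // i /=; rewrite ffunE; exact: (uP i).1.
move=> i j ij /=; rewrite !ffunE; apply/seteqP; split => // x [ix jx].
have [xi _] := (uP i).2 x ix j ij.
have [|_ xj] := (uP j).2 x jx i; first by rewrite eq_sym.
by have [_ _ _ _ <-] := WP (i, j) ij.
Qed.

End config_measurability.

Section measurable_conv.
Context (R : realType) (X : orientedRiemannianManifold R).
Implicit Types G : configs X -> R.

Lemma measurable_conv_one_point_each n (U : 'I_n -> set X) G1 G2 :
  (forall i, open (U i)) -> pairwise_disjoint U ->
  measurable_fun setT G1 -> measurable_fun setT G2 ->
  measurable_fun (one_point_each U) (conv G1 G2).
Proof.
move=> oU U0 mG1 mG2.
pose UI (I : {set 'I_n}) := \bigcup_(i in [set` I]) U i.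
have oUI I : open (UI I) by exact: bigcup_open.
have UI0 I : UI I `&` UI (~: I)%SET = set0.
  apply/seteqP; split=> // x [[i /= iI ix] [j /= jI jx]].
  have ij : i != j by apply: contraTneq jI => <-; rewrite inE iI.
  have : (U i `&` U j) x by [].
  by rewrite (U0 _ _ ij).
have mrestr I : measurable_fun (one_point_each U) (config_restr (UI I)).
  apply: measurable_funS (measurable_config_restr (oUI I) (oUI (~: I)%SET) (UI0 I)).
    apply: measurable_config_open.
    have := config_restr_open (oUI I) (oUI (~: I)%SET) (UI0 I) (@config_openT X).
    by rewrite preimage_setT setIT.
  move=> _ [t -> tU] x; rewrite inE => /tnthP[i ->].
  by have [iI|iI] := boolP (i \in I); [left|right]; exists i => //=; rewrite inE.
apply: (@eq_measurable_fun _ _ _ _ _ (fun eta => \sum_(I : {set 'I_n})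
    G1 (config_restr (UI I) eta) * G2 (config_restr (UI (~: I)%SET) eta))).
  move=> _ /[!inE] -[t -> tU]; have ut := pairwise_disjoint_uniq U0 tU.
  rewrite /conv sum_fpowerset_tuple//; apply: eq_bigr => I _.
  by rewrite subconfigD// !config_restr_subconfig.
apply: measurable_sum => I; apply: measurable_funM; exact: measurableT_comp.
Qed.

Lemma measurable_conv G1 G2 :
  measurable_fun setT G1 -> measurable_fun setT G2 ->
  measurable_fun setT (conv G1 G2).
Proof.
move=> mG1 mG2 _ A mA; rewrite setTI.
have [e [oe eP]] := one_point_each_cover (@mfd_second_countable R X)
  (@mfd_hausdorff R X).
rewrite (_ : _ @^-1` A = \bigcup_(p : {n : nat & {ffun 'I_n -> nat}})
  [set eta | pairwise_disjoint (e \o tagged p) /\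
     (one_point_each (e \o tagged p) `&` conv G1 G2 @^-1` A) eta]).
  apply: (@countable_bigcupT_measurable _ (configs X)
    {n : nat & {ffun 'I_n -> nat}}) => [|[n u] /=]; first exact: countableP.
  have [u0|u0] := pselect (pairwise_disjoint (e \o u)); last first.
    by rewrite (_ : mkset _ = set0)//; apply/seteqP; split=> t //= -[].
  rewrite (_ : mkset _ = one_point_each (e \o u) `&` conv G1 G2 @^-1` A).
    have oeu i : open ((e \o u) i) by exact: oe.
    apply: measurable_conv_one_point_each => //.
    by apply: measurable_config_open; exact: one_point_each_open.
  by apply/seteqP; split=> t //= -[].
apply/seteqP; split=> [eta /= etaA|eta [p _ [_ []]]//].
have [n [u [u0 ueta]]] := eP eta.
by exists (existT (fun k => {ffun 'I_k -> nat}) n u).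
Qed.

End measurable_conv.

(** * Null sets of configurations *)

Section hereditary_null_sets.
Context (R : realType) (X : orientedRiemannianManifold R).
Variable m : {sigma_finite_measure set (borel X) -> \bar R}.
Local Notation Y := (borel X).
Local Notation lambda := (lebesgue_poisson m).

(** The coordinate projection given by a mask is measurable; it is only asserted to
    exist, because its codomain is a type of tuples of computed length. *)
Lemma measurable_mask (bs : bitseq) :
  exists2 g : (size bs).-tuple Y -> (count id bs).-tuple Y,
    measurable_fun setT g & forall t, tval (g t) = mask bs t.
Proof.
elim: bs => [|[] bs [g mg gE]] /=.
- by exists id; [exact: measurable_id|move=> -[[]]].
- exists (fun t : (size bs).+1.-tuple Y =>
    [tuple of thead t :: g [tuple of behead t]]).
    apply: measurable_cons; first exact: measurable_tnth.
    apply: (measurableT_comp mg); exact: measurable_behead.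
  by move=> t; rewrite /= gE; case/tupleP: t => x t.
- exists (fun t : (size bs).+1.-tuple Y => g [tuple of behead t]).
    by apply: (measurableT_comp mg); exact: measurable_behead.
  by move=> t; rewrite gE; case/tupleP: t => x t.
Qed.

(** The sequences of length k in B form a measurable null set for the k-fold
    product of m. Working with a set of sequences rather than of k-tuples avoids
    casts when k is the number of true entries of a mask. *)
Definition null_seqs k (B : set (seq X)) : Prop :=
  measurable [set t : k.-tuple Y | B t] /\
  power_measure m k [set t : k.-tuple Y | B t] = 0%E.

Lemma power_measureS k (A : set (k.+1.-tuple Y)) :
  power_measure m k.+1 A = (power_measure m k \x m)%E (@tuple_rcons R X k @^-1` A).
Proof. by rewrite /= /image_measure setTI. Qed.

Lemma measurable_tuple_rcons k : measurable_fun setT (@tuple_rcons R X k).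
Proof. exact: measurable_cons. Qed.

(** A measurable set of (k+1)-tuples is null iff its section at almost every
    k-tuple of last entries is null. *)
Lemma null_seqs_sections k (B : set (seq X)) :
  measurable [set t : k.+1.-tuple Y | B t] ->
  null_seqs k.+1 B <-> null_seqs k [set s | m [set x | B (x :: s)] != 0%E].
Proof.
move=> mB.
pose D := @tuple_rcons R X k @^-1` [set t : k.+1.-tuple Y | B t].
have mD : measurable D by rewrite -[D]setTI; exact: measurable_tuple_rcons.
have mf := measurable_fun_xsection m mD.
have DE (s : k.-tuple Y) : xsection D s = [set x | B (x :: s)].
  by apply/seteqP; split=> x; rewrite /xsection /= inE.
have mN : measurable [set t : k.-tuple Y | m [set x | B (x :: t)] != 0%E].
  rewrite (_ : mkset _ = setT `&` (m \o xsection D) @^-1` [set~ 0%E]).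
    by apply: mf => //; apply: measurableC.
  by apply/seteqP; split=> [t /eqP|t [_ /eqP]] /=; rewrite DE // => ?; split.
rewrite /null_seqs power_measureS -/D /=.
rewrite (_ : (power_measure m k \x m)%E D =
    (\int[power_measure m k]_t `|(m \o xsection D) t|)%E); last first.
  by apply: eq_integral => t _; rewrite gee0_abs// measure_ge0.
have -> : (\int[power_measure m k]_t `|(m \o xsection D) t| = 0)%E <->
    power_measure m k [set t : k.-tuple Y | m [set x | B (x :: t)] != 0%E] = 0%E.
  rewrite ae_eq_integral_abs//; split=> [ae0|N0].
    apply: measure_negligible => //; apply: negligibleS ae0 => t /= /eqP h.
    by rewrite DE => /(_ Logic.I).
  exists [set t : k.-tuple Y | m [set x | B (x :: t)] != 0%E]; split => // t /=.
  by rewrite DE => h; apply/eqP => h'; apply: h.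
by split=> -[].
Qed.

(** Preimages of null sets under coordinate projections are null. *)
Lemma null_seqs_mask (bs : bitseq) (B : set (seq X)) :
  null_seqs (count id bs) B -> null_seqs (size bs) [set s | B (mask bs s)].
Proof.
elim: bs B => [|[] bs IH] B.
- move=> [mB B0] /=; rewrite /null_seqs.
  rewrite (_ : mkset _ = [set t : 0.-tuple Y | B t])//.
  by apply/funext => -[[]].
- move=> nB; have [mB _] := nB.
  apply/null_seqs_sections.
    have [g mg gE] := measurable_mask (true :: bs).
    rewrite (_ : mkset _ = g @^-1` [set t | B t]).
      by rewrite -[X in measurable X]setTI; exact: mg.
    by apply/funext => t /=; rewrite gE.
  by move/(null_seqs_sections mB) : nB => /IH.
- move=> /IH[mN N0]; set N := [set t | _] in mN N0.
  have NE : [set t : (size bs).+1.-tuple Y | B (mask (false :: bs) t)] =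
      (fun t : (size bs).+1.-tuple Y => [tuple of behead t]) @^-1` N.
    by apply/funext => t; case/tupleP: t => x t.
  rewrite /null_seqs -[size _]/((size bs).+1) NE; split.
    by rewrite -[X in measurable X]setTI; exact: measurable_behead.
  rewrite power_measureS.
  rewrite (_ : _ @^-1` _ = N `*` setT).
    by rewrite product_measure1E// N0 mul0e.
  by apply/seteqP; split=> [[t x]|[t x] []].
Qed.

Lemma measurable_offdiag_config n (A : set (configs X)) : measurable A ->
  measurable [set t : n.-tuple Y | uniq (tval t) /\ A [fset x in tval t]%fset].
Proof.
move=> mA; apply: (measurable_tuple_config (mfd_second_countable X)
  (@mfd_hausdorff R X)) => //.
exact: measurable_offdiag (mfd_second_countable X) (@mfd_hausdorff R X) n.
Qed.

(** A set of configurations is null iff, for each n, the n-tuples of distinct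
    points that enumerate its elements form a null set. *)
Lemma lebesgue_poisson_eq0 (A : set (configs X)) : measurable A ->
  lambda A = 0%E <->
  forall n, null_seqs n [set s | uniq s /\ A [fset x in s]%fset].
Proof.
move=> mA.
pose u n : \bar R := (((n`!)%:R^-1)%:E * power_measure m n
  [set t : n.-tuple Y | uniq (tval t) /\ A [fset x in tval t]%fset])%E.
have -> : lambda A = (\sum_(0 <= n <oo) u n)%E by [].
have u0 n : (0 <= u n)%E.
  by apply: mule_ge0; rewrite ?measure_ge0// lee_fin invr_ge0.
split=> [s0 n|nA]; last first.
  apply: eseries0 => n _ _.
  by have [_ An0] := nA n; rewrite /u [X in (_ * X)%E]An0 mule0.
split; first exact: measurable_offdiag_config.
have : (u n <= 0)%E.
  rewrite -s0 (le_trans _ (@nneseries_lim_ge _ u xpredT 0 n.+1 _))//.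
  rewrite big_mkord big_ord_recr /=.
  by apply: leeDr; exact: sume_ge0.
move=> un0; have : u n = 0%E by apply/eqP; rewrite eq_le un0 u0.
rewrite /u => /eqP; rewrite mule_eq0 => /orP[|/eqP//].
by rewrite eqe invr_eq0 pnatr_eq0 -leqn0 leqNgt fact_gt0.
Qed.

Lemma measurable_superconfigs (M : set (configs X)) : measurable M ->
  measurable [set eta : configs X | exists2 xi, (xi `<=` eta)%fset & M xi].
Proof.
move=> mM; have m1 : measurable_fun setT (\1_M : configs X -> R).
  exact: measurable_indic.
have mc := measurable_conv m1 (measurable_cst (1 : R)).
(* conv \1_M 1 counts the subsets that belong to M *)
rewrite (_ : mkset _ = setT `&` conv (\1_M : configs X -> R) (cst 1) @^-1` [set~ 0]).
  by apply: mc => //; exact: measurableC.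
rewrite setTI; apply/seteqP; split=> eta /=.
  move=> [xi xieta Mxi]; rewrite /conv; apply/eqP.
  rewrite psumr_eq0 => [|zeta _]; last by rewrite mulr1.
  apply/allPn; exists xi; first by rewrite fpowersetE.
  by rewrite /= mulr1 indicE mem_set// oner_eq0.
move/eqP; rewrite /conv psumr_eq0 => [|zeta _]; last by rewrite mulr1.
move=> /allPn[xi]; rewrite fpowersetE => xieta; rewrite /= mulr1 => h.
exists xi => //; apply: contrapT => nM.
by move: h; rewrite indicE memNset// eqxx.
Qed.

(** If almost every configuration is outside N, then almost every configuration
    has no subset in N. *)
Lemma negligible_superconfigs (N : set (configs X)) :
  lambda.-negligible N ->
  lambda.-negligible [set eta | exists2 xi, (xi `<=` eta)%fset & N xi].
Proof.
move=> [M [mM M0 NM]].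
exists [set eta | exists2 xi, (xi `<=` eta)%fset & M xi]; split; first last.
- by move=> eta [xi xieta /NM]; exists xi.
- apply/(lebesgue_poisson_eq0 (measurable_superconfigs mM)) => n.
  have mn := @measurable_offdiag_config n _ (measurable_superconfigs mM).
  split=> //; apply: measure_negligible => //.
  pose B := [set s : seq X | uniq s /\ M [fset x in s]%fset].
  pose F k : set (n.-tuple Y) := if choice.unpickle k is Some bs then
    [set t | B (mask (tval (bs : n.-tuple bool)) (tval t))] else set0.
  apply: (@negligibleS _ _ _ _ (\bigcup_k F k)).
    move=> t /= [ut [xi xit Mxi]].
    pose bs := map_tuple (fun x => x \in xi) t.
    exists (choice.pickle bs) => //; rewrite /F choice.pickleK /B /=.
    rewrite -filter_mask filter_uniq//; split => //.
    rewrite (_ : [fset x in _]%fset = xi)//.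
    apply/fsetP => x; rewrite !inE mem_filter.
    by apply/andb_idr => /(fsubsetP xit); rewrite inE.
  apply: negligible_bigcup => k; rewrite /F.
  case: choice.unpickle => [bs|]; last exact: negligible_set0.
  have := @null_seqs_mask bs B; rewrite size_tuple.
  have /(lebesgue_poisson_eq0 mM) nB := M0.
  move=> /(_ (nB _))[mBbs Bbs0]; exact/negligibleP.
- exact: measurable_superconfigs.
Qed.

Lemma ae_subconfigs (P : configs X -> Prop) : (\forall eta \ae lambda, P eta) ->
  \forall eta \ae lambda, forall xi, (xi `<=` eta)%fset -> P xi.
Proof.
move=> /negligible_superconfigs; apply: negligibleS => eta /= /existsNP[xi].
by move=> /not_implyP[xieta nP]; exists xi.
Qed.

End hereditary_null_sets.

(** * The spaces K_(C, delta) and the maximal convolution operator *)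

Section growth_spaces.
Context (R : realType) (X : orientedRiemannianManifold R).
Variable m : {sigma_finite_measure set (borel X) -> \bar R}.
Local Notation lambda := (lebesgue_poisson m).

(* The almost-everywhere filter of lambda, for filterS and its variants. *)
#[local] Instance ae_lebesgue_poisson_filter :
  Filter (nbhs (almost_everywhere lambda)).
Proof. exact: ae_filter_ringOfSetsType. Qed.

Section representatives.
Variables (C : {posnum R}) (delta : R).
Local Notation V := (growth_space m C delta).

Lemma growth_space_ae_inj (u v : V) :
  (\forall eta \ae lambda, u eta = v eta) -> u = v.
Proof.
by move=> uv; rewrite -(growth_reprK u) -(growth_reprK v) growth_class_eq.
Qed.

Lemma growth_space_of (f : configs X -> R) : growth_bounded m C%:num delta f ->
  exists u : V, \forall eta \ae lambda, u eta = f eta.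
Proof.
move=> fb; have ff : f \in growth_fun m C delta by exact/asboolP.
by exists (growth_class (GrowthFun ff)); exact: growth_classK.
Qed.

Lemma growth_space_bounded (u : V) : growth_bounded m C%:num delta u.
Proof. exact/asboolP/(growth_valP (growth_repr u)). Qed.

Lemma growth_space_linE (c : R) (u v : V) :
  \forall eta \ae lambda, growth_space_fun (c *: u + v) eta = c * u eta + v eta.
Proof.
have -> : c *: u + v = growth_class (c *: growth_repr u + growth_repr v).
  by rewrite growth_classD growth_classZ !growth_reprK.
exact: growth_classK.
Qed.

Lemma growth_space_normP (u : V) :
  \forall eta \ae lambda, `|u eta| <= `|u| * growth C%:num delta eta.
Proof.
have [_ [c uc]] := growth_space_bounded u.
have fin : growth_ess_sup m C delta u \is a fin_num.
  rewrite ge0_fin_numE.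
    apply: (@le_lt_trans _ _ c%:E); last exact: ltry.
    apply/ess_supP; apply: filterS uc => eta.
    by rewrite lee_fin ler_pdivrMr// growth_gt0.
  apply: ess_sup_gee; first exact: lebesgue_poisson_gt0.
  by apply: aeW => eta; rewrite lee_fin divr_ge0// ltW// growth_gt0.
have := ess_sup_ge lambda (fun eta => (`|u eta| / growth C%:num delta eta)%:E).
apply: filterS => eta; rewrite -/(growth_ess_sup m C delta u) -(fineK fin) lee_fin.
by rewrite ler_pdivrMr// growth_gt0.
Qed.

Lemma growth_space_distP (u v : V) :
  \forall eta \ae lambda, `|u eta - v eta| <= `|u - v| * growth C%:num delta eta.
Proof.
have -> : u - v = -1 *: v + u by rewrite scaleN1r addrC.
move: (growth_space_linE (-1) v u) (growth_space_normP (-1 *: v + u)).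
by apply: filterS2 => eta ->; rewrite mulN1r addrC.
Qed.

Lemma growth_space0E : \forall eta \ae lambda, growth_space_fun (0 : V) eta = 0.
Proof.
have <- : -1 *: (0 : V) + 0 = 0 by rewrite scaler0 addr0.
by apply: filterS (growth_space_linE (-1) 0 0) => eta ->; rewrite mulN1r addNr.
Qed.

End representatives.

Lemma conv_linear (a f g : configs X -> R) (c : R) eta :
  conv a (fun xi => c * f xi + g xi) eta = c * conv a f eta + conv a g eta.
Proof.
rewrite /conv mulr_sumr -big_split; apply: eq_bigr => xi _.
by rewrite mulrDr mulrCA.
Qed.

Lemma norm_conv_le (f g F G : configs X -> R) eta :
  (forall xi, (xi `<=` eta)%fset -> `|f xi| <= F xi) ->
  (forall xi, (xi `<=` eta)%fset -> `|g xi| <= G xi) ->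
  `|conv f g eta| <= conv F G eta.
Proof.
move=> fF gG; rewrite /conv (le_trans (ler_norm_sum _ _ _))//.
rewrite big_seq [leRHS]big_seq ler_sum// => xi; rewrite fpowersetE => xieta.
by rewrite normrM ler_pM// ?fF// gG// fsubsetDl.
Qed.

Lemma eq_conv_ae (a f g : configs X -> R) :
  (\forall eta \ae lambda, f eta = g eta) ->
  \forall eta \ae lambda, conv a f eta = conv a g eta.
Proof.
move=> fg0; apply: filterS (ae_subconfigs fg0) => eta fg.
rewrite /conv big_seq [RHS]big_seq; apply: eq_bigr => xi _.
by rewrite fg// fsubsetDl.
Qed.

Lemma conv_growth_le (C1 C2 d1 d2 : R) (eta : configs X) :
  0 <= C1 -> 0 <= C2 -> 0 <= d1 -> d1 <= d2 ->
  conv (growth C1 d1) (growth C2 d2) eta <= growth (C1 + C2) d2 eta.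
Proof.
move=> C10 C20 d10 d12; rewrite /growth -(sum_fpowerset_binomial C1 C2 eta).
rewrite mulr_suml /conv big_seq [leRHS]big_seq ler_sum// => xi.
rewrite fpowersetE => xieta.
rewrite mulrACA ler_wpM2l ?mulr_ge0 ?exprn_ge0//.
have fact_ge1 n : 1 <= (n`!)%:R :> R by rewrite ler1n fact_gt0.
apply: (@le_trans _ _ ((#|` xi|)`!%:R `^ d2 * (#|` eta `\` xi|%fset)`!%:R `^ d2)).
  by rewrite ler_wpM2r ?powR_ge0// ler_powR.
rewrite -powRM ?ler0n// ge0_ler_powR ?nnegrE ?mulr_ge0 ?ler0n//.
  exact: le_trans d12.
have le_xi : (#|` xi| <= #|` eta|)%N by exact: fsubset_leq_card.
rewrite -natrM ler_nat cardfsDS// -(bin_fact le_xi) leq_pmull//.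
by rewrite bin_gt0.
Qed.

Lemma conv_growth_bounded (C1 C2 d1 d2 : R) (f g : configs X -> R) :
  0 <= C1 -> 0 <= C2 -> 0 <= d1 -> d1 <= d2 ->
  growth_bounded m C1 d1 f -> growth_bounded m C2 d2 g ->
  growth_bounded m (C1 + C2) d2 (conv f g).
Proof.
move=> C10 C20 d10 d12 [mf [c fc]] [mg [d gd]].
split; first exact: measurable_conv.
exists (`|c| * `|d|).
move: (ae_subconfigs fc) (ae_subconfigs gd); apply: filterS2 => eta fle gle.
have growth_ge0 (C e : R) (xi : configs X) : 0 <= C -> 0 <= growth C e xi.
  by move=> C0; rewrite mulr_ge0 ?exprn_ge0 ?powR_ge0.
apply: (@le_trans _ _ (conv (fun xi => `|c| * growth C1 d1 xi)
    (fun xi => `|d| * growth C2 d2 xi) eta)).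
  apply: norm_conv_le => xi xieta.
    by rewrite (le_trans (fle _ xieta))// ler_wpM2r ?growth_ge0// ler_norm.
  by rewrite (le_trans (gle _ xieta))// ler_wpM2r ?growth_ge0// ler_norm.
rewrite (_ : conv _ _ _ = `|c| * `|d| * conv (growth C1 d1) (growth C2 d2) eta).
  by rewrite ler_wpM2l ?mulr_ge0// conv_growth_le.
by rewrite /conv mulr_sumr; apply: eq_bigr => xi _; rewrite mulrACA.
Qed.

Section maximal_convolution.
Variables (Ca C : {posnum R}) (deltaa delta : R) (a : growth_space m Ca deltaa).
Local Notation V := (growth_space m C delta).

(** The domain of the maximal convolution operator: all k in K_(C, delta) such
    that conv a k is again in K_(C, delta). The operator itself is conv_op a,
    which does not refer to a domain. *)
Definition conv_maxdom : set V :=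
  [set k : V | exists g : V, \forall eta \ae lambda, g eta = conv a k eta].

Lemma conv_opP (k : V) : conv_maxdom k ->
  \forall eta \ae lambda, growth_space_fun (conv_op a k) eta = conv a k eta.
Proof. by move=> kD; have := getPex kD. Qed.

Lemma conv_op_unique (k g : V) :
  (\forall eta \ae lambda, g eta = conv a k eta) ->
  conv_maxdom k /\ conv_op a k = g.
Proof.
move=> gk; have kD : conv_maxdom k by exists g.
split=> //; apply: growth_space_ae_inj.
by move: (conv_opP kD) gk; apply: filterS2 => eta -> ->.
Qed.

(** The split C = Ca + (C - Ca) is the one matched by the binomial formula. *)
Lemma conv_dom_sub : Ca%:num < C%:num -> 0 <= deltaa -> deltaa <= delta ->
  conv_dom m Ca C delta `<=` conv_maxdom.
Proof.
move=> CaC da0 dad k kb; apply: growth_space_of.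
rewrite -(subrKC Ca%:num C%:num); apply: (@conv_growth_bounded _ _ deltaa) => //.
- by rewrite subr_ge0 ltW.
- exact: growth_space_bounded.
Qed.

Lemma conv_maxdom_linear : linear_operator conv_maxdom (conv_op a).
Proof.
have lin (c : R) (u v : V) : conv_maxdom u -> conv_maxdom v ->
    conv_maxdom (c *: u + v) /\
    conv_op a (c *: u + v) = c *: conv_op a u + conv_op a v.
  move=> uD vD; apply: conv_op_unique.
  have hl := growth_space_linE c (conv_op a u : V) (conv_op a v).
  have hc := eq_conv_ae a (growth_space_linE c u v).
  apply: filterS2 (filterI (conv_opP uD) (conv_opP vD)) (filterI hl hc).
  by move=> eta [eu ev] [-> ->]; rewrite eu ev conv_linear.
split=> //; apply: (proj1 (conv_op_unique (g := 0) _)).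
move: (growth_space0E C delta) (eq_conv_ae a (growth_space0E C delta)).
apply: filterS2 => eta -> ->; rewrite /conv big1// => xi _.
by rewrite mulr0.
Qed.

(** Norm limits of a graph sequence are compared pointwise, off a null set. *)
Lemma conv_maxdom_closed : closed (operator_graph conv_maxdom (conv_op a)).
Proof.
suff graphP (k g : V) : closure (operator_graph conv_maxdom (conv_op a)) (k, g) ->
    operator_graph conv_maxdom (conv_op a) (k, g).
  by move=> [k g]; exact: graphP.
move=> kg.
suff /conv_op_unique[kD kE] : \forall eta \ae lambda, g eta = conv a k eta by [].
have /choice[u uP] : forall n : nat, exists u : V, [/\ conv_maxdom u,
    `|k - u| < n.+1%:R^-1 & `|g - conv_op a u| < n.+1%:R^-1].
  move=> n; have e0 : 0 < n.+1%:R^-1 :> R by rewrite invr_gt0.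
  have [|[u v] [[/= uD ->]]] := kg (ball k n.+1%:R^-1 `*` ball g n.+1%:R^-1).
    by exists (ball k n.+1%:R^-1, ball g n.+1%:R^-1) => //;
      split; exact: nbhsx_ballx.
  by rewrite /= -!ball_normE => -[ku gu]; exists u.
have hk : \forall eta \ae lambda, forall n xi, (xi `<=` eta)%fset ->
    `|k xi - u n xi| <= `|k - u n| * growth C%:num delta xi.
  by apply: ae_foralln => n; apply: ae_subconfigs; exact: growth_space_distP.
have hg : \forall eta \ae lambda, forall n,
    `|g eta - growth_space_fun (conv_op a (u n)) eta| <=
    `|g - conv_op a (u n)| * growth C%:num delta eta.
  by apply: ae_foralln => n; exact: growth_space_distP.
have hu : \forall eta \ae lambda, forall n,
    growth_space_fun (conv_op a (u n) : V) eta = conv a (u n) eta.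
  by apply: ae_foralln => n; apply: conv_opP; case: (uP n).
apply: filterS2 hk (filterI hg hu) => eta kE [gE uE].
(* K / n.+1 bounds |g eta - conv a k eta| for every n *)
pose K := growth C%:num delta eta +
  conv (fun xi => `|a xi|) (growth C%:num delta) eta.
have K_ge0 : 0 <= K.
  rewrite addr_ge0 ?(ltW (growth_gt0 _ _ _))// sumr_ge0// => xi _.
  by rewrite mulr_ge0// ltW// growth_gt0.
have dist_le n : `|g eta - conv a k eta| <= n.+1%:R^-1 * K.
  have [_ /ltW ku /ltW gu] := uP n.
  rewrite (le_trans (ler_distD (conv a (u n) eta) _ _))// mulrDr lerD//.
    by rewrite -uE (le_trans (gE n))// ler_wpM2r// ltW// growth_gt0.
  rewrite distrC (_ : _ - _ = conv a (fun xi => -1 * u n xi + k xi) eta); last first.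
    by rewrite conv_linear mulN1r addrC.
  apply: (@le_trans _ _ (conv (fun xi => `|a xi|)
      (fun xi => n.+1%:R^-1 * growth C%:num delta xi) eta)).
    apply: norm_conv_le => // xi xieta; rewrite mulN1r addrC.
    by rewrite (le_trans (kE n xi xieta))// ler_wpM2r// ltW// growth_gt0.
  by rewrite /conv mulr_sumr ler_sum// => xi _; rewrite mulrCA.
apply/eqP; rewrite -subr_eq0 -normr_le0 leNgt; apply/negP => x0.
have := archi_boundP (divr_ge0 K_ge0 (ltW x0)).
rewrite ltr_pdivrMr// ltNge => /negP; apply.
set N := Num.bound _; have := dist_le N; rewrite mulrC ler_pdivlMr// => KN.
by rewrite (le_trans _ KN)// mulrC ler_wpM2l// ler_nat.
Qed.

End maximal_convolution.
End growth_spaces.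

Theorem proposition4p1 (R : realType) (X : orientedRiemannianManifold R)
  (X_connected : connected [set: X])
  (X_noncompact : ~ compact [set: X])
  (m : {sigma_finite_measure set (borel X) -> \bar R})
  (m_radon : forall L : set (borel X), measurable L ->
     compact (closure (L : set X)) -> (m L < +oo)%E)
  (m_nonatomic : forall x : X, m [set x] = 0%E)
  (X_exhaustion : exists L : nat -> set (borel X),
     [/\ forall n, measurable (L n) /\ compact (closure (L n : set X)),
         forall n, L n `<=` L n.+1 &
         \bigcup_n L n = setT])
  (Ca C : {posnum R}) (deltaa delta : R)
  (deltaa_ge0 : 0 <= deltaa) (CaC : Ca%:num < C%:num)
  (deltaa_delta : deltaa <= delta)
  (a : growth_space m Ca deltaa) :
  closable (conv_dom m Ca C delta) (conv_op a).
Proof.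
exists (conv_maxdom a), (conv_op a); split=> //.
  by split; [exact: conv_maxdom_linear|exact: conv_maxdom_closed].
exact: conv_dom_sub.
Qed.
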